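(* Let $c\ge 0$ be a fixed real number. Then $$\lim_{n\to\infty}\frac{n^{[c\sqrt{n}]}}{(n+1)(n+2)\cdots[n+c\sqrt{n}]}=\exp\left(-\tfrac12c^2\right),$$ where $n$ runs through the positive integers and the denominator is the product of all integers from $n+1$ to $[n+c\sqrt{n}]$ (equal to $1$ if this range is empty).
   Context: For real $x$, $[x]=\max\{z\in\mathbb{Z}:z\le x\}$ denotes the integer part of $x$. *)

(* Defs.v *)
From mathcomp Require Import all_boot all_order all_algebra.
From mathcomp Require Import reals exp.

Set Implicit Arguments.
Unset Strict Implicit.
Unset Printing Implicit Defensive.

Import Order.TTheory GRing.Theory Num.Theory.

Local Open Scope ring_scope.

(* The product runs over the integers k with n + 1 <= k <= [n + c sqrt n].
   Num.floor is int-valued: the exponent is an int power, and the absolute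
   value in the range only casts a floor that is nonnegative for c >= 0. *)
Definition sqrt_ratio (R : realType) (c : R) (n : nat) : R :=
  n%:R ^ Num.floor (c * Num.sqrt n%:R) /
  \prod_(n.+1 <= k < `|Num.floor (n%:R + c * Num.sqrt n%:R)|%N.+1) k%:R.

(* Main.v *)
Require Import Defs.
From mathcomp Require Import all_boot all_order all_algebra.
From mathcomp Require Import all_classical all_reals all_analysis.
From mathcomp Require Import ring lra.

Import Order.TTheory GRing.Theory Num.Theory.
Import numFieldNormedType.Exports.

Local Open Scope classical_set_scope.
Local Open Scope ring_scope.

(** With m = [c sqrt n], the ratio is the product of the n / (n + j), 1 <= j <= m.
    Since 1 + x <= exp x, both n / (n + j) = 1 - j / (n + j) <= exp (- j / (n + m))
    and (n + j) / n = 1 + j / n <= exp (j / n), so the ratio lies between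
    exp (- m (m + 1) / (2 n)) and exp (- m (m + 1) / (2 (n + m))). Both exponents
    tend to - c^2 / 2 because m / sqrt n tends to c. *)

(** An integer summand comes out of the floor, so exponent and range are governed by the same
    natural number [m], which opens the way to induction on [m]. *)
Lemma sqrt_ratioE (R : realType) (c : R) (n : nat) : 0 <= c ->
  let m := `|Num.floor (c * Num.sqrt n%:R)|%N in
  sqrt_ratio c n = n%:R ^+ m / \prod_(n.+1 <= k < (n + m).+1) k%:R.
Proof.
move=> c0 m.
have s0 : 0 <= c * Num.sqrt (n%:R : R) by rewrite mulr_ge0 ?sqrtr_ge0.
have mE : Num.floor (c * Num.sqrt n%:R) = m%:Z.
  by rewrite /m gez0_abs // floor_ge0.
rewrite /sqrt_ratio floorDzr ?natr_int // mE -exprnP.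
by have -> : Num.floor (n%:R : R) = n%:Z by rewrite -[n%:R]/(n%:Z%:~R) intrKfloor.
Qed.

Lemma exp_div_prod_ge (R : realType) (n m : nat) : (0 < n)%N ->
  expR (- (m%:R * (m%:R + 1) / (2 * n%:R)))
    <= n%:R ^+ m / \prod_(n.+1 <= k < (n + m).+1) k%:R :> R.
Proof.
move=> n0; have n0' : 0 < n%:R :> R by rewrite ltr0n.
elim: m => [|m IH].
  by rewrite addn0 big_geq // expr0 !mul0r oppr0 expR0 divr1.
rewrite addnS big_nat_recr ?ltnS ?leq_addr //= exprSr.
(* The exponent is the triangular sum of the [j / n], so passing to [m.+1] adds just the term for
   the new factor. *)
have -> : - (m.+1%:R * (m.+1%:R + 1) / (2 * n%:R)) =
    - (m%:R * (m%:R + 1) / (2 * n%:R)) + - (m.+1%:R / n%:R) :> R.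
  rewrite -natr1; field; lra.
rewrite expRD -[leRHS]mulf_div ler_pM ?expR_ge0 // expRN -[leRHS]invf_div lef_pV2.
- apply: le_trans (expR_ge1Dx _).
  by rewrite -addnS natrD mulrDl divff ?gt_eqF.
- by rewrite posrE expR_gt0.
- by rewrite posrE divr_gt0.
Qed.

(** The bound is wanted for [N = n + m], but a separate [N] keeps the denominator of the exponent
    fixed while [m] grows in the induction. *)
Lemma exp_div_prod_le (R : realType) (n m N : nat) : (0 < n)%N -> (n + m <= N)%N ->
  n%:R ^+ m / \prod_(n.+1 <= k < (n + m).+1) k%:R
    <= expR (- (m%:R * (m%:R + 1) / (2 * N%:R))) :> R.
Proof.
move=> n0; have n0' : 0 < n%:R :> R by rewrite ltr0n.
elim: m => [|m IH] mN.
  by rewrite addn0 big_geq // expr0 !mul0r oppr0 expR0 divr1.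
have N0 : 0 < N%:R :> R by rewrite ltr0n (leq_trans _ mN) // addn_gt0 n0.
rewrite addnS big_nat_recr ?ltnS ?leq_addr //= exprSr.
have -> : - (m.+1%:R * (m.+1%:R + 1) / (2 * N%:R)) =
    - (m%:R * (m%:R + 1) / (2 * N%:R)) + - (m.+1%:R / N%:R) :> R.
  rewrite -natr1; field; lra.
rewrite expRD -[leLHS]mulf_div ler_pM ?divr_ge0 ?exprn_ge0 ?prodr_ge0 //.
  by apply: IH; rewrite (leq_trans _ mN) // leq_add2l.
apply: le_trans (expR_ge1Dx _).
have nm0 : 0 < (n + m).+1%:R :> R by rewrite ltr0n.
have -> : n%:R / (n + m).+1%:R = 1 - m.+1%:R / (n + m).+1%:R :> R.
  by rewrite -[X in X - _](divff (lt0r_neq0 nm0)) -mulrBl -addnS natrD addrK.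
by rewrite lerD2l lerN2 ler_pM2l ?ltr0n // lef_pV2 ?posrE // ler_nat -addnS.
Qed.

Lemma cvg_inv_sqrtn (R : realType) :
  (Num.sqrt (n%:R : R))^-1 @[n --> \oo] --> (0 : R).
Proof.
(* As the square root of [1 / n], the sequence is handled by continuity of the square root at 0. *)
under eq_fun do rewrite -sqrtrV ?ler0n //.
rewrite -[X in nbhs X](sqrtr0 R).
apply: continuous_cvg; first exact: sqrt_continuous.
apply/gtr0_cvgV0; last exact: cvgr_idn.
by near=> n; rewrite ltr0n; near: n; exists 1%N.
Unshelve. all: by end_near. Qed.

(** The floor loses less than 1, hence less than [1 / sqrt n] after the division. *)
Lemma cvg_floor_div_sqrtn (R : realType) (c : R) : 0 <= c ->
  `|Num.floor (c * Num.sqrt (n%:R : R))|%N%:R / Num.sqrt n%:R @[n --> \oo] --> c.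
Proof.
move=> c0; pose y n : R := (Num.sqrt n%:R)^-1.
apply: (@squeeze_cvgr _ _ _ _ (fun n => c - y n) (fun=> c)).
- near=> n.
  have s0 : 0 < Num.sqrt (n%:R : R).
    by rewrite sqrtr_gt0 ltr0n; near: n; exists 1%N.
  have cs0 : 0 <= c * Num.sqrt n%:R by rewrite mulr_ge0 // ltW.
  rewrite natr_absz ger0_norm ?floor_ge0 // ler_pdivrMr // floor_le andbT.
  rewrite ler_pdivlMr // mulrBl mulVf ?gt_eqF // lerBlDr.
  by rewrite -(intrD _ _ 1) ltW // floorD1_gt.
- have := cvgB (cvg_cst c) (@cvg_inv_sqrtn R); rewrite subr0; exact.
- exact: cvg_cst.
Unshelve. all: by end_near. Qed.

Theorem mainTheorem4 (R : realType) (c : R) (hc : 0 <= c) :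
  sqrt_ratio c n @[n --> \oo] --> expR (- (2^-1 * c ^+ 2)).
Proof.
pose m n := `|Num.floor (c * Num.sqrt (n%:R : R))|%N.
(* For positive [n], [n = 1 / y ^ 2] and [m = x / y]. Thus [m (m + 1) / n = x (x + y)] and
   [n + m = n (1 + x y)], so both exponents are rational in [x] and [y], and their limits follow
   from those of [x] and [y]. *)
pose y n : R := (Num.sqrt n%:R)^-1.
pose x n : R := (m n)%:R * y n.
have xc : x n @[n --> \oo] --> c by exact: cvg_floor_div_sqrtn.
have y0 : y n @[n --> \oo] --> 0 by exact: cvg_inv_sqrtn.
have lowc : 2^-1 * (x n * (x n + y n)) @[n --> \oo] --> 2^-1 * c ^+ 2.
  have := cvgM (cvg_cst (2^-1 : R)) (cvgM xc (cvgD xc y0)).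
  by rewrite addr0 -expr2; exact.
have uppc : 2^-1 * (x n * (x n + y n)) / (1 + x n * y n) @[n --> \oo]
    --> 2^-1 * c ^+ 2.
  have den1 : 1 + x n * y n @[n --> \oo] --> (1 : R).
    by have := cvgD (cvg_cst (1 : R)) (cvgM xc y0); rewrite mulr0 addr0; exact.
  by have := cvgM lowc (cvgV (oner_neq0 _) den1); rewrite invr1 mulr1; exact.
have exp_cvg (u : nat -> R) (l : R) :
    u n @[n --> \oo] --> l -> expR (- u n) @[n --> \oo] --> expR (- l).
  move=> ul; apply: (continuous_cvg _ (@continuous_expR R _)).
  exact: cvgN.
apply: (squeeze_cvgr _ (exp_cvg _ _ lowc) (exp_cvg _ _ uppc)).
near=> n.
have n0 : (0 < n)%N by near: n; exists 1%N.
have s0 : 0 < Num.sqrt (n%:R : R) by rewrite sqrtr_gt0 ltr0n.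
have sE : n%:R = Num.sqrt (n%:R : R) ^+ 2 by rewrite sqr_sqrtr.
have s_neq0 := lt0r_neq0 s0.
have m0 : 0 <= (m n)%:R :> R by [].
rewrite sqrt_ratioE // -/(m n); apply/andP; split.
- suff -> : 2^-1 * (x n * (x n + y n)) = (m n)%:R * ((m n)%:R + 1) / (2 * n%:R).
    exact: exp_div_prod_ge.
  by rewrite /x /y [in RHS]sE; field.
- suff -> : 2^-1 * (x n * (x n + y n)) / (1 + x n * y n) =
      (m n)%:R * ((m n)%:R + 1) / (2 * (n + m n)%:R).
    exact: exp_div_prod_le.
  rewrite /x /y natrD [in RHS]sE; field.
  (* The denominators to be kept away from zero are [sqrt n] and [n + m]. *)
  by rewrite s_neq0 andbT gt_eqF // ltr_wpDr // exprn_gt0.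
Unshelve. all: by end_near. Qed.
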